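(* For every integer $n\ge 1$ there exists a bijection $\phi_1:\pi_{ped}(n)\to \pi_{DE1}(n)\cup\pi_{DE1}(n-1)$. In particular, $\mathrm{DE1}(n)+\mathrm{DE1}(n-1)=\mathrm{ped}(n)$; that is, $\mathrm{DE1}(n)+\mathrm{DE1}(n-1)$ equals the number of $4$-regular partitions of $n$.
   Context: A partition of a positive integer $n$ is a finite non-increasing sequence $\lambda=(\lambda_1,\ldots,\lambda_k)$ of positive integers with $\sum_{i=1}^k\lambda_i=n$. $\pi_{ped}(n)$ is the set of partitions of $n$ in which no even part is repeated (odd parts may repeat), and $\mathrm{ped}(n)=|\pi_{ped}(n)|$. $\pi_{DE1}(n)$ is the set of partitions of $n$ in which no even part is repeated and the largest part is odd, and $\mathrm{DE1}(n)=|\pi_{DE1}(n)|$; equivalently $\sum_{n\ge 0}\mathrm{DE1}(n)q^n=\sum_{n\ge0}\frac{(-q^2;q^2)_n q^{2n+1}}{(q;q^2)_{n+1}}$, where $(a;q)_n=\prod_{j=0}^{n-1}(1-aq^j)$. In particular $\pi_{DE1}(0)=\emptyset$ and $\mathrm{DE1}(0)=0$. The sets $\pi_{DE1}(n)$ and $\pi_{DE1}(n-1)$ consist of partitions of different integers, so their union is disjoint. A $4$-regular partition is a partition none of whose parts is divisible by $4$. *)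

(* Defs.v *)
From mathcomp Require Import all_boot.
From mathcomp Require Import finmap.

Set Implicit Arguments.
Unset Strict Implicit.
Unset Printing Implicit Defensive.

Local Open Scope fset_scope.

Definition is_partition_of (n : nat) (s : seq nat) : bool :=
  [&& sorted geq s, all (fun x => 0 < x) s & sumn s == n].

(* The sequences of length at most n with entries at most n serve only as a
   finite ambient set; [in_partitions] shows that no partition is lost. *)
Definition partitions (n : nat) : {fset seq nat} :=
  [fset s in [seq map val (bseqval t) | t : n.-bseq 'I_n.+1]
     | is_partition_of n s].

Lemma in_partitions (n : nat) (s : seq nat) :
  (s \in partitions n) = is_partition_of n s.
Proof.
rewrite !inE /=; case Hs: (is_partition_of n s); last by rewrite andbF.
rewrite andbT; case/and3P: Hs => _ pos_s /eqP sum_s.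
have size_s : size s <= n.
  rewrite -sum_s; elim: s pos_s {sum_s} => //= x s IHs /andP[x_gt0 /IHs le_s].
  by rewrite -add1n leq_add.
have bound_s : all (fun x => x < n.+1) s.
  apply/allP => x; rewrite ltnS -sum_s {pos_s sum_s size_s}.
  elim: s => //= y s IHs; rewrite inE => /predU1P[-> | /IHs le_x].
    exact: leq_addr.
  exact: leq_trans le_x (leq_addl _ _).
pose t := [seq inord x : 'I_n.+1 | x <- s].
have size_t : size t <= n by rewrite size_map.
apply/imageP; exists (Bseq size_t) => //=.
rewrite -map_comp -[LHS]map_id; apply/eq_in_map => x xs /=.
by rewrite inordK // (allP bound_s).
Qed.

Definition even_parts_distinct (s : seq nat) : bool :=
  uniq [seq x <- s | ~~ odd x].

(* The empty partition has largest part 0, hence is not counted by DE1. *)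
Definition largest_part (s : seq nat) : nat := \max_(x <- s) x.

Definition regular4 (s : seq nat) : bool := all (fun x => ~~ (4 %| x)) s.

Definition pi_ped (n : nat) : {fset seq nat} :=
  [fset s in partitions n | even_parts_distinct s].

Definition pi_DE1 (n : nat) : {fset seq nat} :=
  [fset s in partitions n | even_parts_distinct s && odd (largest_part s)].

Definition pi_reg4 (n : nat) : {fset seq nat} :=
  [fset s in partitions n | regular4 s].

Definition ped (n : nat) : nat := #|` pi_ped n|.
Definition DE1 (n : nat) : nat := #|` pi_DE1 n|.
Definition reg4 (n : nat) : nat := #|` pi_reg4 n|.

(* Main.v *)
(** [phi1] fixes a partition whose largest part is odd.  An even largest part
    occurs once, so lowering it by 1 keeps it largest and makes it odd;
    conversely raising an odd largest part by 1 makes it an even part larger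
    than all others.
    For the 4-regular partitions, [(1 + q^a) / (1 - q^(2a)) = 1 / (1 - q^a)]:
    partitions in which [a] occurs at most once and [2a] is unrestricted
    correspond to those in which [a] is unrestricted and [2a] does not occur.
    Exchanging these conditions for the even [a], from the largest down to 2,
    turns "no even part is repeated" into "no part is divisible by 4". *)

Require Import Defs.
From mathcomp Require Import all_boot.
From mathcomp Require Import finmap.
From mathcomp Require Import zify.

(** * Bijections between finite sets *)

Lemma fset_bijection (T : choiceType) (A B : {fset T}) (f g : T -> T) :
    {in A, forall x, f x \in B} -> {in B, forall x, g x \in A} ->
    {in A, cancel f g} -> {in B, cancel g f} ->
  exists h : A -> B, bijective h.
Proof.
move=> fAB gBA fK gK.
exists (fun x : A => [` fAB _ (valP x)]%fset).
exists (fun y : B => [` gBA _ (valP y)]%fset) => x; apply: val_inj => /=.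
  exact: fK (valP x).
exact: gK (valP x).
Qed.

Lemma fset_bijection_card (T : choiceType) (A B : {fset T}) (h : A -> B) :
  bijective h -> #|` A|%fset = #|` B|%fset.
Proof. by move=> /bij_eq_card; rewrite !cardfE. Qed.

(** * Membership in the three families of partitions *)

Lemma largest_part_head (s : seq nat) :
  sorted geq s -> largest_part s = head 0 s.
Proof.
rewrite /largest_part; case: s => [|x s] /=; first by rewrite big_nil.
rewrite path_sortedE; last by move=> a b c /=; lia.
case/andP=> /allP le_x _; rewrite big_cons; apply/maxn_idPl.
by apply/bigmax_leqP_seq => y /le_x.
Qed.

Lemma in_pi_ped n s :
  (s \in pi_ped n) = is_partition_of n s && even_parts_distinct s.
Proof. by rewrite in_fset inE /= in_partitions. Qed.

Lemma in_pi_DE1 n s : (s \in pi_DE1 n) =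
  [&& is_partition_of n s, even_parts_distinct s & odd (head 0 s)].
Proof.
rewrite in_fset inE /= in_partitions; case Ps: (is_partition_of n s) => //=.
by case/and3P: Ps => /largest_part_head ->.
Qed.

Lemma in_pi_reg4 n s :
  (s \in pi_reg4 n) = is_partition_of n s && regular4 s.
Proof. by rewrite in_fset inE /= in_partitions. Qed.

(** * The bijection behind [phi1] *)

Definition lower_even_head (s : seq nat) : seq nat :=
  if odd (head 0 s) then s else (head 0 s).-1 :: behead s.

(** The sum of [s] tells which set of the disjoint union it comes from. *)
Definition raise_head (n : nat) (s : seq nat) : seq nat :=
  if sumn s == n then s else (head 0 s).+1 :: behead s.

Lemma even_parts_distinct_cons x s : even_parts_distinct (x :: s) =
  (odd x || (x \notin s)) && even_parts_distinct s.
Proof.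
rewrite /even_parts_distinct /=; case ox: (odd x) => //=.
by rewrite mem_filter ox.
Qed.

Lemma is_partition_of_cons n x s : is_partition_of n (x :: s) =
  [&& all (geq x) s, 0 < x, x <= n & is_partition_of (n - x) s].
Proof.
rewrite /is_partition_of /= path_sortedE; last by move=> a b c /=; lia.
(* The conjunct [x <= n] guards the truncated subtraction. *)
have -> : (x + sumn s == n) = (x <= n) && (sumn s == n - x) by lia.
by case: (all (geq x) s); case: (sorted _ _); case: (0 < x); case: (x <= n);
   rewrite //= andbF.
Qed.

Lemma in_lower_even_head n s : 0 < n -> s \in pi_ped n ->
  lower_even_head s \in (pi_DE1 n `|` pi_DE1 (n - 1))%fset.
Proof.
rewrite in_fsetU !in_pi_DE1 in_pi_ped /lower_even_head => n_gt0.
case: ifP => [-> /andP[-> ->] //|]; case: s => [|x s] /=.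
  (* The empty list has default head 0, which is even; [0 < n] excludes it. *)
  by rewrite /is_partition_of /=; lia.
rewrite !is_partition_of_cons !even_parts_distinct_cons => ex.
rewrite ex /= => /andP[/and4P[/allP le_x x_gt0 le_xn Ps] /andP[xs Es]].
apply/orP; right; rewrite Es.
have -> : n - 1 - x.-1 = n - x by lia.
have ox: odd x.-1 by lia.
rewrite Ps ox !andbT /=; apply/and3P; split; [|lia|lia].
(* The even part [x] does not recur, so every other part is at most [x.-1]. *)
apply/allP => y ys /=; have /= := le_x _ ys.
have : y != x by apply: contraNneq xs => <-.
lia.
Qed.

Lemma in_raise_head n t : 0 < n ->
  t \in (pi_DE1 n `|` pi_DE1 (n - 1))%fset -> raise_head n t \in pi_ped n.
Proof.
move=> n_gt0; rewrite in_fsetU !in_pi_DE1 in_pi_ped /raise_head.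
case/orP=> /and3P[Pt Et ot].
  by have /and3P[_ _ ->] := Pt; rewrite Pt Et.
have /and3P[_ _ /eqP ->] := Pt.
have -> : n - 1 == n = false by lia.
case: t Pt Et ot => //= x s.
rewrite !is_partition_of_cons !even_parts_distinct_cons.
case/and4P=> /allP le_x x_gt0 le_xn Ps /andP[_ Es] ox.
have -> : n - x.+1 = n - 1 - x by lia.
rewrite Ps Es /= !andbT -!andbA; apply/and3P; split; [|lia|].
  by apply/allP => y /le_x /=; lia.
apply/orP; right; apply/negP => /le_x /=; lia.
Qed.

Lemma lower_even_headK n : 0 < n ->
  {in pi_ped n, cancel lower_even_head (raise_head n)}.
Proof.
move=> n_gt0 s; rewrite in_pi_ped /lower_even_head /raise_head.
case/andP=> Ps _; have /and3P[_ pos_s /eqP sum_s] := Ps.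
case: (odd (head 0 s)); first by rewrite sum_s eqxx.
case: s pos_s sum_s {Ps} => [|x s] /=; first lia.
case/andP=> x_gt0 _ sum_s.
by have -> : x.-1 + sumn s == n = false by [lia]; rewrite prednK.
Qed.

Lemma raise_headK n : 0 < n ->
  {in (pi_DE1 n `|` pi_DE1 (n - 1))%fset,
    cancel (raise_head n) lower_even_head}.
Proof.
move=> n_gt0 t; rewrite in_fsetU !in_pi_DE1 /lower_even_head /raise_head.
case/orP=> /and3P[Pt _ ot]; have /and3P[_ _ /eqP ->] := Pt.
  by rewrite eqxx ot.
have -> : n - 1 == n = false by lia.
by case: t ot {Pt} => //= x s ->.
Qed.

Lemma card_DE1_union n : 0 < n ->
  #|` (pi_DE1 n `|` pi_DE1 (n - 1))%fset|%fset = DE1 n + DE1 (n - 1).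
Proof.
move=> n_gt0; rewrite cardfsU (_ : (_ `&` _)%fset = fset0) ?cardfs0 ?subn0 //.
apply/fsetP => s; rewrite in_fsetI !in_pi_DE1 in_fset0.
apply/negP => /andP[/and3P[/and3P[_ _ sum_s] _ _]].
by case/and3P=> /and3P[_ _]; lia.
Qed.

(** * Partitions described by their multiplicities *)

Lemma partition_count_inj n s t : is_partition_of n s -> is_partition_of n t ->
  (forall x, count_mem x s = count_mem x t) -> s = t.
Proof.
case/and3P=> ss _ _ /and3P[st _ _] eq_st.
apply: (sorted_eq (leT := geq)) => //.
- by move=> a b c /=; lia.
- by move=> a b /=; lia.
- by apply/allP => x _ /=; rewrite eq_st.
Qed.

(** Common form of splitting and merging: the multiplicities of [a] and [a.*2] are overwritten, and
    sorting restores a partition. *)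
Definition set_counts (a i j : nat) (s : seq nat) : seq nat :=
  sort geq (nseq i a ++ nseq j a.*2 ++
            [seq x <- s | (x != a) && (x != a.*2)]).

Lemma count_set_counts a i j s x : 0 < a -> count_mem x (set_counts a i j s) =
  if x == a then i else if x == a.*2 then j else count_mem x s.
Proof.
move=> a_gt0; rewrite /set_counts.
have /permP -> := permEl (perm_sort geq (nseq i a ++ nseq j a.*2 ++
                           [seq x <- s | (x != a) && (x != a.*2)])).
rewrite !count_cat !count_nseq count_filter /=.
case: (eqVneq x a) => [->|xa].
  rewrite (_ : a.*2 == a = false); last lia.
  rewrite (eq_count (a2 := pred0)) ?count_pred0; first lia.
  by move=> y /=; case: (y == a).
case: (eqVneq x a.*2) => [->|x2a].
  rewrite (eq_count (a2 := pred0)) ?count_pred0; first lia.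
  by move=> y /=; case: (y == a.*2) => //=; rewrite andbF.
rewrite !mul0n !add0n; apply: eq_count => y /=.
by case: eqP => // ->; rewrite xa x2a.
Qed.

Lemma sumn_filter_part a s : 0 < a -> sumn s =
  count_mem a s * a + count_mem a.*2 s * a.*2 +
  sumn [seq x <- s | (x != a) && (x != a.*2)].
Proof.
move=> a_gt0; elim: s => //= x s ->.
case: (eqVneq x a) => [->|_] /=.
  by rewrite (_ : a == a.*2 = false); lia.
by case: (eqVneq x a.*2) => [->|_] /=; lia.
Qed.

(** The parts [a] and [a.*2] contribute [a * (i + j.*2)] to the sum, which the hypothesis keeps
    fixed. *)
Lemma is_partition_of_set_counts n a i j s : 0 < a ->
    i + j.*2 = count_mem a s + (count_mem a.*2 s).*2 ->
  is_partition_of n s -> is_partition_of n (set_counts a i j s).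
Proof.
move=> a_gt0 eq_ij /and3P[_ pos_s /eqP sum_s]; apply/and3P; split.
- by apply: sort_sorted => x y /=; exact: leq_total.
- rewrite all_sort !all_cat !all_nseq double_gt0 a_gt0 !orbT /=.
  by apply/allP => x; rewrite mem_filter => /andP[_ /(allP pos_s)].
- rewrite (perm_sumn (permEl (perm_sort _ _))) !sumn_cat !sumn_nseq.
  by rewrite -sum_s (sumn_filter_part a s a_gt0); nia.
Qed.

(** * From distinct even parts to 4-regular partitions *)

Definition split_parts (a : nat) (s : seq nat) : seq nat :=
  set_counts a (count_mem a s + (count_mem a.*2 s).*2) 0 s.

(** Copies of [a] are paired off, leaving at most one. The old multiplicity of [a.*2] is discarded,
    so the sum is preserved only when it was 0. *)
Definition merge_parts (a : nat) (s : seq nat) : seq nat :=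
  set_counts a (odd (count_mem a s)) (count_mem a s)./2 s.

(* The multiplicities [m] allowed for the part [x] once the even [a > 2k] have
   been treated: [2a] is then forbidden and [a] is no longer restricted to
   occur at most once. *)
Definition allowed_count (k x m : nat) : bool :=
  [|| odd x, m == 0 |
      if x <= k.*2 then m == 1 else (4 %| x) ==> (x <= k.*2.*2)].

Definition stage (n k : nat) : {fset seq nat} :=
  [fset s in partitions n |
    all (fun x => allowed_count k x (count_mem x s)) s]%fset.

Lemma in_stageP n k s :
  reflect (is_partition_of n s /\
           forall x, allowed_count k x (count_mem x s)) (s \in stage n k).
Proof.
rewrite in_fset inE /= in_partitions; apply: (iffP andP) => -[Ps Cs]; split=> //.
  move=> x; case: (boolP (x \in s)) => [/(allP Cs) //|/count_memPn ->].
  by rewrite /allowed_count eqxx orbT.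
by apply/allP => x _; exact: Cs.
Qed.

(** No positive part satisfies [x <= 0], so only the ban on multiples of 4 remains. *)
Lemma stage0 n : stage n 0 = pi_reg4 n.
Proof.
apply/fsetP => s; rewrite in_pi_reg4; apply/in_stageP/andP => -[Ps Cs].
  split=> //; apply/allP => x xs; have /and3P[_ pos_s _] := Ps.
  have x_gt0 := allP pos_s x xs.
  have := Cs x; rewrite /allowed_count.
  have : 0 < count_mem x s by rewrite -has_count has_pred1.
  case: (count_mem x s) => // m _; case: ifP; lia.
split=> // x; rewrite /allowed_count.
case: (boolP (x \in s)) => [xs|/count_memPn ->]; last by rewrite eqxx orbT.
have /and3P[_ pos_s _] := Ps.
have := allP pos_s x xs; have := allP Cs x xs => /=.
by case: ifP; lia.
Qed.

(** Parts are at most [n <= n.*2], so every even part falls under the bound of one occurrence. *)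
Lemma stage_max n : stage n n = pi_ped n.
Proof.
apply/fsetP => s; rewrite in_pi_ped; apply/in_stageP/andP => -[Ps Cs].
all: split=> //; have /and3P[_ _ /eqP sum_s] := Ps.
all: have le_n x : x \in s -> x <= n.
1,3: by move=> xs; rewrite -sum_s sumnE (big_rem x xs) leq_addr.
  rewrite /even_parts_distinct; apply: count_mem_uniq => x.
  rewrite mem_filter count_filter.
  case: (boolP (x \in s)) => xs; last first.
    rewrite andbF; apply/eqP; rewrite -leqn0 -(count_memPn xs).
    by apply: sub_count => y /= /andP[].
  case ox: (odd x) => /=.
    rewrite (eq_count (a2 := pred0)) ?count_pred0 // => y /=.
    by case: eqP => //= ->; rewrite ox.
  rewrite (eq_count (a2 := pred1 x)); last first.
    by move=> y /=; case: eqP => //= ->; rewrite ox.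
  have := Cs x; rewrite /allowed_count ox.
  have : 0 < count_mem x s by rewrite -has_count has_pred1.
  have := le_n _ xs; case: ifP; lia.
move=> x; rewrite /allowed_count.
case: (boolP (x \in s)) => [xs|/count_memPn ->]; last by rewrite eqxx orbT.
case ox: (odd x) => //=.
have -> : x <= n.*2 by have := le_n _ xs; lia.
have := count_uniq_mem x Cs; rewrite mem_filter ox xs /= => <-.
rewrite count_filter; apply/orP; right; apply/eqP/eq_count => y /=.
by case: eqP => //= ->; rewrite ox.
Qed.

(** With [a = k.+1.*2], the two stages differ only at [a], which becomes unrestricted, and at
    [a.*2], which becomes forbidden. If 4 divides [a] then [k > 0], so [a <= k.*2.*2] and [a] is
    indeed free in [stage n k]. *)
Lemma stage_step n k : exists h : stage n k.+1 -> stage n k, bijective h.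
Proof.
have a_gt0 : 0 < k.+1.*2 by lia.
have splitP s x := count_set_counts k.+1.*2
  (count_mem k.+1.*2 s + (count_mem k.+1.*2.*2 s).*2) 0 s x a_gt0.
have mergeP s x := count_set_counts k.+1.*2
  (odd (count_mem k.+1.*2 s)) (count_mem k.+1.*2 s)./2 s x a_gt0.
have split_part s :
    is_partition_of n s -> is_partition_of n (split_parts k.+1.*2 s).
  by apply: is_partition_of_set_counts => //; lia.
have count_double s :
    s \in stage n k -> count_mem k.+1.*2.*2 s = 0.
  by case/in_stageP=> _ /(_ k.+1.*2.*2); rewrite /allowed_count; case: ifP; lia.
have merge_part s : s \in stage n k ->
    is_partition_of n (merge_parts k.+1.*2 s).
  move=> Ss; have /in_stageP[Ps _] := Ss.
  apply: is_partition_of_set_counts => //.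
  by rewrite (count_double s Ss); lia.
have split_stage : {in stage n k.+1,
    forall s, split_parts k.+1.*2 s \in stage n k}.
  move=> s /in_stageP[Ps Cs]; apply/in_stageP; split; first exact: split_part.
  move=> x; have := Cs x; rewrite splitP /allowed_count.
  by do !case: ifP; lia.
have merge_stage : {in stage n k,
    forall s, merge_parts k.+1.*2 s \in stage n k.+1}.
  move=> s Ss; have /in_stageP[Ps Cs] := Ss.
  apply/in_stageP; split; first exact: merge_part.
  move=> x; have := Cs x; rewrite mergeP /allowed_count.
  by do !case: ifP; lia.
apply: (fset_bijection _ _ _ _ _ split_stage merge_stage) => s Ss.
  have /in_stageP[Ps Cs] := Ss.
  apply: (partition_count_inj n) => //; first exact/merge_part/split_stage.
  move=> x; rewrite mergeP !splitP eqxx.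
  (* Here [a] occurs [m <= 1] times, so the parity and the half of [m + j.*2] recover [m] and
     [j]. *)
  have := Cs k.+1.*2; rewrite /allowed_count.
  case: (eqVneq x k.+1.*2) => [->|_]; first by case: ifP; lia.
  by case: (eqVneq x k.+1.*2.*2) => [->|_]; first by case: ifP; lia.
have /in_stageP[Ps Cs] := Ss.
apply: (partition_count_inj n) => //; first exact/split_part/merge_part.
move=> x; rewrite splitP !mergeP eqxx.
(* Parity plus twice the half restores the count of [a]; that of [a.*2] was 0 already. *)
case: (eqVneq x k.+1.*2) => [->|_].
  by rewrite (_ : k.+1.*2.*2 == k.+1.*2 = false) ?eqxx; lia.
by case: (eqVneq x k.+1.*2.*2) => [->|_] //; rewrite count_double.
Qed.

Lemma ped_reg4 n : ped n = reg4 n.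
Proof.
rewrite /ped /reg4 -stage0 -(stage_max n).
(* Only the stage index varies; the partitioned integer [n] stays fixed. *)
elim: {2}n => // k IHk; have [h /fset_bijection_card ->] := stage_step n k.
exact: IHk.
Qed.

Theorem lemma2p4 (n : nat) (hn : 0 < n) :
  (exists phi1 : pi_ped n -> (pi_DE1 n `|` pi_DE1 (n - 1))%fset, bijective phi1) /\
  DE1 n + DE1 (n - 1) = ped n /\
  DE1 n + DE1 (n - 1) = reg4 n.
Proof.
have ex_phi1 := fset_bijection _ _ _ _ _ (fun s => in_lower_even_head n s hn)
  (fun t => in_raise_head n t hn) (lower_even_headK n hn) (raise_headK n hn).
have card_ped : DE1 n + DE1 (n - 1) = ped n.
  have [phi1 /fset_bijection_card card_phi1] := ex_phi1.
  by rewrite -card_DE1_union // -card_phi1.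
by rewrite -ped_reg4.
Qed.
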